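(* Let $(\mathcal{V},\Omega,\mathcal{E})$ be a tomographically complete generalized probabilistic theory and let $d\in\mathbb{N}$. Then $(\mathcal{V},\Omega,\mathcal{E})$ is simplex-embeddable in $d$ dimensions if and only if the prepare-and-measure scenario $(\Omega,\mathcal{E})$ admits an operationally noncontextual ontological model with a discrete ontic space of finite cardinality $d$.
   Context: Generalized probabilistic theory. $\mathcal{V}$ is a finite-dimensional real inner product space; $\Omega,\mathcal{E}\subseteq\mathcal{V}$ are nonempty bounded convex sets with $\langle s,e\rangle_{\mathcal{V}}\ge0$ for all $s\in\Omega$, $e\in\mathcal{E}$; $0\in\mathcal{E}$; there is $u\in\mathcal{E}$ with $\langle s,u\rangle_{\mathcal{V}}=1$ for all $s\in\Omega$; and for every $e\in\mathcal{E}$ there is a (finite or countable) family $\{e_k\in\mathcal{E}\}_k$ with $e+\sum_ke_k=u$. It is tomographically complete if $\mathrm{span}(\Omega)=\mathrm{span}(\mathcal{E})=\mathcal{V}$. In general the reduced space is the orthogonal projection of $\mathrm{span}(\Omega)$ onto $\mathrm{span}(\mathcal{E})$; in the tomographically complete case it equals $\mathcal{V}$ and the projection onto it is the identity. Model (tomographically complete case, discrete ontic space $\Lambda$ of cardinality $d$). An operationally noncontextual ontological model for $(\Omega,\mathcal{E})$ is a pair of maps $\mu:\Omega\times\Lambda\to\mathbb{R}$, $\xi:\mathcal{E}\times\Lambda\to\mathbb{R}$ such that: $\mu\ge0$ and $\sum_{\lambda\in\Lambda}\mu(\rho,\lambda)=1$ for all $\rho\in\Omega$; for each $\lambda$, $\mu(\cdot,\lambda)$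 is convex-linear, i.e. $\mu(p\rho_1+(1-p)\rho_2,\lambda)=p\mu(\rho_1,\lambda)+(1-p)\mu(\rho_2,\lambda)$ for $p\in[0,1]$, $\rho_1,\rho_2\in\Omega$; $\xi\ge0$ and, for each $\lambda$, each $K\in\mathbb{N}\cup\{+\infty\}$ and each family $\{E_k\in\mathcal{E}\}_{k=1}^K$ with $\sum_{k=1}^KE_k=u$, $\sum_{k=1}^K\xi(E_k,\lambda)=1$; for each $\lambda$, $\xi(\cdot,\lambda)$ is convex-linear on $\mathcal{E}$; and $\langle\rho,E\rangle_{\mathcal{V}}=\sum_{\lambda\in\Lambda}\mu(\rho,\lambda)\xi(E,\lambda)$ for all $\rho\in\Omega$, $E\in\mathcal{E}$. Simplex-embeddability. A tomographically complete $(\mathcal{V},\Omega,\mathcal{E})$ is simplex-embeddable in $d$ dimensions if there exist: a $d$-dimensional real inner product space $\mathcal{W}$; a simplex $\Delta_d\subset\mathcal{W}$ which is the convex hull of $d$ linearly independent vertices $\{\delta_i\in\mathcal{W}\}_{i=1}^d$; a linear map $\iota:\mathcal{V}\to\mathcal{W}$ with $\iota(\Omega)\subseteq\Delta_d$; and a linear map $\kappa:\mathcal{V}\to\mathcal{W}$ with $\langle\kappa(E),\delta_i\rangle_{\mathcal{W}}\in[0,1]$ for all $E\in\mathcal{E}$ and $i=1,\dots,d$; such that $\langle\rho,E\rangle_{\mathcal{V}}=\langle\iota(\rho),\kappa(E)\rangle_{\mathcal{W}}$ for all $\rho\in\Omega$, $E\in\mathcal{E}$. *)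

(* Defs.v *)
From HB Require Import structures.
From mathcomp Require Import all_boot all_order all_algebra.
From mathcomp Require Import all_classical all_reals all_analysis.
Set Implicit Arguments.
Unset Strict Implicit.
Unset Printing Implicit Defensive.
Import Order.TTheory GRing.Theory Num.Theory.
Import numFieldNormedType.Exports.
Local Open Scope classical_set_scope.
Local Open Scope ring_scope.

Section InnerProductSpace.
Variables (R : realType) (V : vectType R) (dot : {dot V for idfun}).

Definition dot_norm (v : V) : R := Num.sqrt (dot v v).

Definition dot_bounded (A : set V) : Prop :=
  exists M : R, forall v, A v -> dot_norm v <= M.

(* [V] carries no canonical topology, so convergence of a series is expressed
   through the norm of the inner product. *)
Definition dot_has_sum (x : nat -> V) (l : V) : Prop :=
  (fun n => dot_norm (series x n - l)) @ \oo --> (0 : R).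

Definition set_span (A : set V) : set V :=
  [set v | exists2 X : seq V, (forall x, x \in X -> A x) & v \in <<X>>%VS].

Definition convex_linear_on (A : set V) (f : V -> R) : Prop :=
  forall (p : R) (x y : V), 0 <= p <= 1 -> A x -> A y ->
    f (p *: x + (1 - p) *: y) = p * f x + (1 - p) * f y.

Definition conv_hull (d : nat) (x : 'I_d -> V) : set V :=
  [set v | exists a : 'I_d -> R,
     [/\ forall i, 0 <= a i, \sum_i a i = 1 & v = \sum_i a i *: x i]].

End InnerProductSpace.

Section GeneralizedProbabilisticTheory.
Variables (R : realType) (V : vectType R) (dot : {dot V for idfun}).
Variables (Omega E : set V) (u : V).

Record is_gpt : Prop := IsGPT {
  gpt_states_nonempty : Omega !=set0;
  gpt_states_bounded : dot_bounded dot Omega;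
  gpt_states_convex : convex_set Omega;
  gpt_effects_nonempty : E !=set0;
  gpt_effects_bounded : dot_bounded dot E;
  gpt_effects_convex : convex_set E;
  gpt_dot_ge0 : forall s e, Omega s -> E e -> 0 <= dot s e;
  gpt_effects0 : E 0;
  gpt_effects_unit : E u;
  gpt_dot_unit : forall s, Omega s -> dot s u = 1;
  gpt_complement : forall e, E e ->
    (exists (K : nat) (f : 'I_K -> V),
       (forall k, E (f k)) /\ e + \sum_k f k = u) \/
    (exists f : nat -> V,
       (forall k, E (f k)) /\ exists2 s, dot_has_sum dot f s & e + s = u)
}.

Definition tomographically_complete : Prop :=
  set_span Omega = [set: V] /\ set_span E = [set: V].

(* [mu] and [xi] are total on [V], but only their values on [Omega] and on [E],
   respectively, are constrained. *)
Record is_noncontextual_model (Lambda : finType)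
    (mu : V -> Lambda -> R) (xi : V -> Lambda -> R) : Prop :=
  IsNoncontextualModel {
  ncm_mu_ge0 : forall rho l, Omega rho -> 0 <= mu rho l;
  ncm_mu_sum1 : forall rho, Omega rho -> \sum_l mu rho l = 1;
  ncm_mu_convex_linear : forall l, convex_linear_on Omega (mu^~ l);
  ncm_xi_ge0 : forall e l, E e -> 0 <= xi e l;
  ncm_xi_sum1_finite : forall (l : Lambda) (K : nat) (f : 'I_K -> V),
    (forall k, E (f k)) -> \sum_k f k = u -> \sum_k xi (f k) l = 1;
  ncm_xi_sum1_countable : forall (l : Lambda) (f : nat -> V),
    (forall k, E (f k)) -> dot_has_sum dot f u ->
    series (fun k => xi (f k) l) @ \oo --> (1 : R);
  ncm_xi_convex_linear : forall l, convex_linear_on E (xi^~ l);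
  ncm_dot : forall rho e, Omega rho -> E e ->
    dot rho e = \sum_l mu rho l * xi e l
}.

Definition admits_noncontextual_model (d : nat) : Prop :=
  exists (Lambda : finType) (mu xi : V -> Lambda -> R),
    #|Lambda| = d /\ is_noncontextual_model mu xi.

Definition simplex_embeddable (d : nat) : Prop :=
  exists (W : vectType R) (dotW : {dot W for idfun}) (delta : d.-tuple W)
    (iota kappa : {linear V -> W}),
    [/\ \dim {:W} = d,
        free delta,
        iota @` Omega `<=` conv_hull (tnth delta),
        forall e i, E e -> 0 <= dotW (kappa e) (tnth delta i) <= 1 &
        forall rho e, Omega rho -> E e -> dot rho e = dotW (iota rho) (kappa e)].

End GeneralizedProbabilisticTheory.

(* Main.v *)
(* A convex-linear function on a convex set spanning [V] extends to a linear
   functional, hence is of the form [dot w], as soon as it preserves linear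
   relations; the unit effect (for states) and the effect 0 (for effects) ensure
   that every relation may be taken to have total weight zero. So the maps of a
   noncontextual model are families of linear functionals, i.e. linear maps into
   R^d, where the basis vectors span the simplex. Conversely the coordinates of
   [iota] and the pairings of [kappa] with the vertices form a model, where
   countable additivity comes from Riesz representation and Cauchy-Schwarz. *)
From HB Require Import structures.
Require Import Defs.
From mathcomp Require Import all_boot all_order all_algebra.
From mathcomp Require Import all_classical all_reals all_analysis.
From mathcomp Require Import ring lra.
Set Implicit Arguments.
Unset Strict Implicit.
Unset Printing Implicit Defensive.
Import Order.TTheory GRing.Theory Num.Theory.
Import numFieldNormedType.Exports.
Local Open Scope classical_set_scope.
Local Open Scope ring_scope.

(** * Prepending an element to a finite family *)

Definition ord_cons (T : Type) (n : nat) (x : T) (a : 'I_n -> T)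
    (i : 'I_n.+1) :=
  oapp a x (unlift ord0 i).

Lemma ord_consP (T : Type) (P : T -> Prop) (n : nat) (x : T) (a : 'I_n -> T) :
  P x -> (forall i, P (a i)) -> forall i, P (ord_cons x a i).
Proof. by move=> Px Pa i; rewrite /ord_cons; case: (unlift ord0 i). Qed.

Lemma big_ord_cons (T : Type) (V : zmodType) (n : nat) (g : T -> V) (x : T)
    (a : 'I_n -> T) :
  \sum_i g (ord_cons x a i) = g x + \sum_i g (a i).
Proof.
rewrite big_ord_recl /ord_cons unlift_none; congr (_ + _).
by apply: eq_bigr => i _; rewrite liftK.
Qed.

Lemma big_ord_cons2 (T U : Type) (V : zmodType) (n : nat) (g : T -> U -> V)
    (x : T) (a : 'I_n -> T) (y : U) (b : 'I_n -> U) :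
  \sum_i g (ord_cons x a i) (ord_cons y b i) = g x y + \sum_i g (a i) (b i).
Proof.
rewrite big_ord_recl /ord_cons !unlift_none; congr (_ + _).
by apply: eq_bigr => i _; rewrite liftK.
Qed.

(** * Finite spanning lists *)

Section Span.
Variables (R : realType) (V : vectType R).

(** Each vector of a basis of [V] needs only a finite list from [A]; the concatenation of these
    lists spans [V]. *)
Lemma set_span_fullv (A : set V) : set_span A = [set: V] ->
  exists2 X : seq V, (forall x, x \in X -> A x) & <<X>>%VS = fullv.
Proof.
move=> spanA.
have spanP v : exists X : seq V, (forall x, x \in X -> A x) /\ v \in <<X>>%VS.
  have : set_span A v by rewrite spanA.
  by case=> X AX vX; exists X.
pose Y v := projT1 (cid (spanP v)).
have YP v : (forall x, x \in Y v -> A x) /\ v \in <<Y v>>%VS.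
  exact: projT2 (cid (spanP v)).
exists (flatten [seq Y v | v <- vbasis {:V}]).
  by move=> x /flatten_mapP[v _]; exact: (YP v).1.
apply/eqP; rewrite eqEsubv subvf /=.
rewrite -[X in (X <= _)%VS](span_basis (vbasisP {:V})).
apply/span_subvP => v vb; apply: subvP (YP v).2; apply: sub_span => x xY.
by apply/flatten_mapP; exists v.
Qed.

End Span.

(** * Convex-linear functions and linear relations *)

Section ConvexLinear.
Variables (R : realType) (V : vectType R) (A : set V) (f : V -> R).
Hypotheses (convA : convex_set A) (linf : convex_linear_on A f).

Lemma convex_set_comb (p : R) (x y : V) : 0 <= p <= 1 -> A x -> A y ->
  A (p *: x + (1 - p) *: y).
Proof.
case/andP=> p0 p1 Ax Ay.
by have := convA (Itv01 p0 p1) (mem_set Ax) (mem_set Ay); rewrite inE.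
Qed.

(** Induction on [r]: the new term and the point found so far merge into one convex combination.
    Keeping the total weight as a factor covers weight zero, where any point of [A] serves. *)
Lemma convex_linear_sum (I : Type) (r : seq I) (c : I -> R) (a : I -> V) :
  A !=set0 -> (forall i, 0 <= c i) -> (forall i, A (a i)) ->
  exists x, [/\ A x, \sum_(i <- r) c i *: a i = (\sum_(i <- r) c i) *: x &
    \sum_(i <- r) c i * f (a i) = (\sum_(i <- r) c i) * f x].
Proof.
move=> [x0 Ax0] c0 Aa; elim: r => [|i r [x [Ax xE fE]]].
  by exists x0; rewrite !big_nil scale0r mul0r.
have : 0 <= \sum_(i <- r) c i by apply: sumr_ge0.
rewrite !big_cons xE fE; set t := \sum_(i <- r) c i => t0.
have [ct0|ct0] := eqVneq (c i + t) 0.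
  have ci0 : c i = 0 by have := c0 i; lra.
  have {}t0 : t = 0 by lra.
  by exists x; rewrite ci0 t0 addr0 !scale0r !mul0r !addr0.
have ct_gt0 : 0 < c i + t by rewrite lt_neqAle eq_sym ct0 addr_ge0.
have p01 : 0 <= c i / (c i + t) <= 1.
  by rewrite divr_ge0 ?(ltW ct_gt0)// ler_pdivrMr// mul1r lerDl.
have pE : 1 - c i / (c i + t) = t / (c i + t) by field.
exists ((c i / (c i + t)) *: a i + (1 - c i / (c i + t)) *: x); split.
- exact: convex_set_comb.
- rewrite pE scalerDr !scalerA !mulrA.
  by rewrite ![(c i + t) * _]mulrC !mulfK.
- by rewrite linf// pE; field.
Qed.

(* Adding [`|c i|] to both sides turns a relation into an equality of
   nonnegative combinations of equal total weight. *)
Lemma convex_linear_relation (n : nat) (c : 'I_n -> R) (a : 'I_n -> V) :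
  A !=set0 -> (forall i, A (a i)) -> \sum_i c i = 0 -> \sum_i c i *: a i = 0 ->
  \sum_i c i * f (a i) = 0.
Proof.
move=> A0 Aa c0 ca0; pose p i := `|c i|; pose q i := `|c i| - c i.
have q0 i : 0 <= q i by rewrite subr_ge0 ler_norm.
have [x [Ax xE fxE]] :=
  convex_linear_sum (index_enum 'I_n) A0 (fun i => normr_ge0 (c i)) Aa.
have [y [Ay yE fyE]] := convex_linear_sum (index_enum 'I_n) A0 q0 Aa.
have qpE : \sum_i q i = \sum_i p i by rewrite sumrB c0 subr0.
have xyE : (\sum_i p i) *: x = (\sum_i p i) *: y.
  rewrite -{2}qpE -xE -yE; under [RHS]eq_bigr do rewrite scalerBl.
  by rewrite sumrB ca0 subr0.
(* Cancelling a nonzero weight gives [x = y]; at weight zero the two points may differ, but both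
   sides vanish. *)
have fxyE : (\sum_i p i) * f x = (\sum_i p i) * f y.
  have [->|p0] := eqVneq (\sum_i p i) 0; first by rewrite !mul0r.
  by congr (_ * f _); exact: (scalerI p0).
have : \sum_i q i * f (a i) = \sum_i p i * f (a i) - \sum_i c i * f (a i).
  by rewrite -sumrB; apply: eq_bigr => i _; rewrite mulrBl.
by rewrite fyE fxE qpE fxyE => /esym/eqP; rewrite subr_eq addrC -subr_eq subrr
  => /eqP.
Qed.

(** Giving the point [0] the weight [- s] makes the total weight zero and, since [f 0 = 0], changes
    neither sum. *)
Lemma convex_linear_relation0 (n : nat) (c : 'I_n -> R) (a : 'I_n -> V) :
  A 0 -> f 0 = 0 -> (forall i, A (a i)) -> \sum_i c i *: a i = 0 ->
  \sum_i c i * f (a i) = 0.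
Proof.
move=> A0 f0 Aa ca0.
pose s := \sum_i c i.
have := convex_linear_relation (ex_intro _ 0 A0) (ord_consP A0 Aa)
  (c := ord_cons (- s) c).
rewrite (big_ord_cons id).
rewrite (big_ord_cons2 (fun t x => t *: x)).
rewrite (big_ord_cons2 (fun t x => t * f x)).
by rewrite /= scaler0 f0 mulr0 !add0r; apply; rewrite ?addNr.
Qed.

End ConvexLinear.

(** * Inner products: Cauchy-Schwarz, Riesz representation, series *)

Section DotProduct.
Variables (R : realType) (V : vectType R) (dot : {dot V for idfun}).

Lemma dotC v w : dot v w = dot w v.
Proof. by rewrite (hermC dot) expr0 mul1r. Qed.

Lemma dot_ge0 v : 0 <= dot v v.
Proof.
have [->|v0] := eqVneq v 0; first by rewrite linear0r.
exact/ltW/neq0_dnorm_gt0.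
Qed.

Lemma dotZr a v w : dot v (a *: w) = a * dot v w.
Proof. by rewrite linearZr_LR. Qed.

Lemma dot_cauchy_schwarz v w : `|dot v w| <= dot_norm dot v * dot_norm dot w.
Proof.
rewrite -sqrtr_sqr /dot_norm -sqrtrM ?dot_ge0// ler_wsqrtr//.
have [->|w0] := eqVneq w 0; first by rewrite !linear0r expr0n.
have ww_gt0 : 0 < dot w w by exact: neq0_dnorm_gt0.
(* This vector is [dot w w] times the part of [v] orthogonal to [w]; its squared norm is [dot w w]
   times the Gram determinant. *)
have := dot_ge0 (dot w w *: v - dot v w *: w).
rewrite linearBl !linearBr /= !linearZl_LR /= !dotZr (dotC w v) => h.
have {h} : 0 <= dot w w * (dot v v * dot w w - dot v w ^+ 2).
  by apply: (le_trans h); rewrite le_eqVlt; apply/orP; left; apply/eqP; ring.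
by rewrite pmulr_rge0// subr_ge0.
Qed.

(** The map [g] pairs a vector with each element of a basis. It is injective, since a vector
    orthogonal to a basis is orthogonal to itself; hence [L] factors through [g], and the
    coefficients of the factor give [w]. *)
Lemma riesz (L : {linear V -> R^o}) : exists w, forall v, L v = dot w v.
Proof.
pose b := vbasis {:V}; pose n : nat := \dim {:V}.
pose g v : 'rV[R]_n := \row_i dot (tnth b i) v.
have ling : linear g.
  by move=> a x y; apply/rowP => i; rewrite !mxE linearDr /= dotZr.
pose g' : {linear V -> 'rV[R]_n} :=
  HB.pack g (GRing.isLinear.Build R V 'rV[R]_n *:%R g ling).
pose G := linfun g'.
have kerG : lker G == 0%VS.
  apply/eqP/vspaceP => v; rewrite memv0 memv_ker lfunE /=; apply/eqP/eqP.
  - move=> gv0; apply/eqP; apply: contraT => /(neq0_dnorm_gt0 (s := dot)).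
    rewrite {1}(coord_vbasis (memvf v)) linear_sumlz big1 ?ltxx// => i _.
    rewrite linearZl_LR /=; have /rowP/(_ i) := gv0.
    by rewrite !mxE (tnth_nth 0) => ->; rewrite mulr0.
  - by move=> ->; apply/rowP => i; rewrite !mxE linear0r.
exists (\sum_i L (G^-1%VF (delta_mx 0 i)) *: tnth b i) => v.
rewrite -{1}(lker0_lfunK kerG v) lfunE /= (row_sum_delta (g v)) !linear_sum.
rewrite linear_sumlz; apply: eq_bigr => i _.
by rewrite !linearZ linearZl_LR !mxE /= mulrC.
Qed.

(** The spanning list [t] need not be free: [coord t] is linear and reconstructs every vector in any
    case, so it defines a functional [L] from the values of [f] on [t]. *)
Lemma dot_extension (A : set V) (f : V -> R) : set_span A = [set: V] ->
  (forall n (c : 'I_n -> R) (a : 'I_n -> V), (forall i, A (a i)) ->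
    \sum_i c i *: a i = 0 -> \sum_i c i * f (a i) = 0) ->
  exists w, forall x, A x -> f x = dot w x.
Proof.
move=> /set_span_fullv[X AX spanX] relf; pose t := in_tuple X.
have At i : A (tnth t i) by apply/AX/mem_tnth.
pose L v : R^o := \sum_i coord t i v * f (tnth t i).
have linL : linear L.
  move=> a x y; rewrite /L scaler_sumr -big_split; apply: eq_bigr => i _ /=.
  by rewrite linearP mulrDl -mulrA.
pose L' : {linear V -> R^o} :=
  HB.pack L (GRing.isLinear.Build R V R^o *:%R L linL).
have [w wE] := riesz L'; exists w => x Ax; rewrite -wE.
have xE : \sum_i coord t i x *: tnth t i = x.
  have xX : x \in <<t>>%VS by rewrite spanX memvf.
  by rewrite [RHS](coord_span xX); apply: eq_bigr => i _; rewrite (tnth_nth 0).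
(* The relation expressing [x] through [t], with [x] itself at coefficient [-1], forces [f x] to
   equal [L x]. *)
have := relf _ (ord_cons (-1) (coord t ^~ x)) _ (ord_consP Ax At).
rewrite (big_ord_cons2 (fun t x => t *: x)).
rewrite (big_ord_cons2 (fun t x => t * f x)).
rewrite /= xE scaleN1r addNr mulN1r => /(_ erefl)/eqP.
by rewrite addrC subr_eq0 => /eqP.
Qed.

Lemma dot_has_sum_dot w (x : nat -> V) l : dot_has_sum dot x l ->
  series (fun k => dot w (x k)) @ \oo --> (dot w l : R).
Proof.
move=> xl; apply/cvgrPdist_le => e e0.
(* The [+ 1] keeps the divisor positive when [w = 0]. *)
have M0 : 0 < dot_norm dot w + 1 by rewrite ltr_pwDr// sqrtr_ge0.
have /cvgrPdist_le/(_ (e / (dot_norm dot w + 1))) := xl.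
rewrite divr_gt0// => /(_ isT); apply: filterS => n.
rewrite sub0r normrN ger0_norm ?sqrtr_ge0// ler_pdivlMr// => h.
rewrite distrC /series /= -linear_sumr -linearBr; apply: (le_trans _ h).
rewrite (le_trans (dot_cauchy_schwarz _ _))// mulrC ler_wpM2l ?sqrtr_ge0//.
by rewrite lerDl.
Qed.

Lemma dot_has_sum_cons e (x : nat -> V) s : dot_has_sum dot x s ->
  dot_has_sum dot (fun k => if k is k'.+1 then x k' else e) (e + s).
Proof.
(* The new partial sum at index [n.+1] is [e] plus the old one at [n], so the errors agree after a
   shift. *)
rewrite /dot_has_sum => xs; rewrite -(cvg_shiftS (fun n => dot_norm dot _)) /=.
apply: cvg_trans xs; apply: near_eq_cvg; near=> n => /=.
congr (dot_norm _ _); rewrite /series /= big_nat_recl//= opprD addrACA subrr.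
by rewrite add0r.
Unshelve. all: by end_near. Qed.

End DotProduct.

(** * From a simplex embedding to a model *)

Section EmbeddingModel.
Variables (R : realType) (V : vectType R) (dot : {dot V for idfun}).
Variables (Omega E : set V) (u : V) (d : nat).
Hypothesis gpt : is_gpt dot Omega E u.

(** Pairing with a fixed vector is linear and continuous, so finite and countable normalisation both
    reduce to the value at [u]. *)
Lemma dot_response_model (mu : V -> 'I_d -> R) (w : 'I_d -> V) :
  (forall i, convex_linear_on Omega (mu^~ i)) ->
  (forall rho i, Omega rho -> 0 <= mu rho i) ->
  (forall rho, Omega rho -> \sum_i mu rho i = 1) ->
  (forall i e, E e -> 0 <= dot (w i) e) -> (forall i, dot (w i) u = 1) ->
  (forall rho e, Omega rho -> E e ->
    dot rho e = \sum_i mu rho i * dot (w i) e) ->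
  is_noncontextual_model dot Omega E u mu (fun e i => dot (w i) e).
Proof.
move=> mulin mu0 mu1 w0 w1 dotE; split => //.
- by move=> e i; exact: w0.
- by move=> i K f _ fu; rewrite -linear_sumr fu /= w1.
- by move=> i f _ fu; rewrite -(w1 i); exact: dot_has_sum_dot.
- by move=> i p x y _ _ _; rewrite linearDr /= !dotZr.
Qed.

(* [kappa u] need not pair to [1] with a vertex outside the support of every
   [iota rho]; such a vertex gets the response function of a fixed state. *)
Lemma simplex_embeddable_model : simplex_embeddable dot Omega E d ->
  admits_noncontextual_model dot Omega E u d.
Proof.
move=> [W [dotW [delta [iota [kappa [_ freed iotaO kappaE dotE]]]]]].
(* Barycentric coordinates: freeness makes them the only weights on the vertices, and [coord] makes
   them linear. *)
pose mu rho i := coord delta i (iota rho).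
have muP rho : Omega rho -> [/\ forall i, 0 <= mu rho i, \sum_i mu rho i = 1 &
    iota rho = \sum_i mu rho i *: tnth delta i].
  move=> Orho; have [a [a0 a1 aE]] := iotaO _ (imageP iota Orho).
  have muE i : mu rho i = a i.
    rewrite /mu aE; under eq_bigr do rewrite (tnth_nth 0).
    exact: coord_sum_free.
  split => [i||]; rewrite ?muE//.
    by rewrite -a1; apply: eq_bigr.
  by rewrite aE; apply: eq_bigr => i _; rewrite muE.
pose x i e := dotW (kappa e) (tnth delta i).
have dotxE rho e : Omega rho -> E e -> dot rho e = \sum_i mu rho i * x i e.
  move=> Orho Ee; rewrite dotE//; have [_ _ ->] := muP _ Orho.
  rewrite linear_sumlz; apply: eq_bigr => i _.
  by rewrite linearZl_LR /= dotC.
have Eu := gpt_effects_unit gpt.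
have wP i : exists w, [/\ forall e, E e -> 0 <= dot w e, dot w u = 1 &
    forall rho e, Omega rho -> E e -> mu rho i * x i e = mu rho i * dot w e].
  have [[rho Orho mui0]|nsupp] :=
      pselect (exists2 rho, Omega rho & mu rho i != 0).
    have linx : linear (x i : V -> R^o).
      by move=> a v w; rewrite /x linearP linearDl linearZl_LR.
    pose L : {linear V -> R^o} :=
      HB.pack (x i : V -> R^o) (GRing.isLinear.Build R V R^o *:%R _ linx).
    have [w wE] := riesz dot L; have {}wE e : x i e = dot w e := wE e.
    exists w; split => [e Ee||rho' e _ _]; rewrite -?wE//.
      by have /andP[] := kappaE e i Ee.
    have [mu0 mu1 _] := muP _ Orho.
    (* The average of the [x j u], each at most 1, with weights [mu rho j] is [dot rho u = 1], so
       [x j u = 1] wherever the weight is nonzero. *)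
    have sum0 : \sum_j mu rho j * (1 - x j u) = 0.
      under eq_bigr do rewrite mulrBr mulr1.
      by rewrite sumrB mu1 -dotxE// (gpt_dot_unit gpt)// subrr.
    have /psumr_eq0P/(_ sum0 i isT)/eqP :
        forall j, true -> 0 <= mu rho j * (1 - x j u).
      by move=> j _; rewrite mulr_ge0// subr_ge0; have /andP[] := kappaE u j Eu.
    by rewrite mulf_eq0 (negbTE mui0) /= subr_eq0 eq_sym => /eqP.
  have [rho0 Orho0] := gpt_states_nonempty gpt.
  exists rho0; split => [e Ee||rho e Orho _].
  - exact: (gpt_dot_ge0 gpt).
  - exact: (gpt_dot_unit gpt).
  - suff -> : mu rho i = 0 by rewrite !mul0r.
    by apply/eqP; apply: contra_notT nsupp => mui0; exists rho.
have [w {}wP] := choice wP.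
exists 'I_d, mu, (fun e i => dot (w i) e); split; first exact: card_ord.
apply: dot_response_model.
- by move=> i p v v2 _ _ _; rewrite /mu !linearD !linearZ.
- by move=> rho i /muP[].
- by move=> rho /muP[].
- by move=> i; have [] := wP i.
- by move=> i; have [] := wP i.
- move=> rho e Orho Ee; rewrite dotxE//; apply: eq_bigr => i _.
  by have [_ _ ->] := wP i.
Qed.

End EmbeddingModel.

(** * The standard inner product on row vectors *)

Section RowDot.
Variables (R : realType) (d : nat).

Definition row_dot (v w : 'rV[R]_d) : R := \sum_i v 0 i * w 0 i.

Fact row_dot_bilinear : bilinear_for *%R (idfun \; *%R) row_dot.
Proof.
split=> [w|v] a x y; rewrite /row_dot /= mulr_sumr -big_split;
  by apply: eq_bigr => i _ /=; rewrite !mxE; ring.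
Qed.

HB.instance Definition _ :=
  bilinear_isBilinear.Build R 'rV[R]_d 'rV[R]_d R *%R (idfun \; *%R)
    row_dot row_dot_bilinear.

Fact row_dot_sym (v w : 'rV[R]_d) :
  row_dot v w = (-1) ^+ false * idfun (row_dot w v).
Proof. by rewrite expr0 mul1r; apply: eq_bigr => i _; rewrite mulrC. Qed.

HB.instance Definition _ :=
  isHermitianSesquilinear.Build R 'rV[R]_d false idfun row_dot row_dot_sym.

Fact row_dot_gt0 (v : 'rV[R]_d) : v != 0 -> 0 < row_dot v v.
Proof.
move=> v0; rewrite lt_neqAle sumr_ge0 ?andbT; last first.
  by move=> i _; rewrite -expr2 sqr_ge0.
apply: contra v0; rewrite eq_sym => /eqP vv0; apply/eqP/rowP => i; rewrite mxE.
have /psumr_eq0P/(_ vv0 i isT)/eqP : forall j, true -> 0 <= v 0 j * v 0 j.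
  by move=> j _; rewrite -expr2 sqr_ge0.
by rewrite mulf_eq0 orbb => /eqP.
Qed.

HB.instance Definition _ :=
  isDotProduct.Build R 'rV[R]_d row_dot row_dot_gt0.

End RowDot.

(** * From a model to a simplex embedding *)

Section ModelEmbedding.
Variables (R : realType) (V : vectType R) (dot : {dot V for idfun}).

Definition dot_row (d : nat) (w : 'I_d -> V) (v : V) : 'rV[R]_d :=
  \row_i dot (w i) v.

Fact dot_row_linear (d : nat) (w : 'I_d -> V) : linear (dot_row w).
Proof. by move=> a x y; apply/rowP => i; rewrite !mxE linearDr /= dotZr. Qed.

HB.instance Definition _ (d : nat) (w : 'I_d -> V) :=
  GRing.isLinear.Build R V 'rV[R]_d *:%R (dot_row w) (dot_row_linear w).

Variables (Omega E : set V) (u : V).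
Hypotheses (gpt : is_gpt dot Omega E u).
Hypothesis tomo : tomographically_complete Omega E.

Section Model.
Variables (Lambda : finType) (mu xi : V -> Lambda -> R).
Hypothesis ncm : is_noncontextual_model dot Omega E u mu xi.

(** The families [u] and [0, u] both sum to [u]; their normalisations differ by [xi 0 l]. *)
Lemma model_xi0 l : xi 0 l = 0.
Proof.
have Eu := gpt_effects_unit gpt; have E0 := gpt_effects0 gpt.
have := ncm_xi_sum1_finite ncm l (fun _ : 'I_1 => Eu).
have := ncm_xi_sum1_finite ncm l (f := ord_cons 0 (fun _ : 'I_1 => u))
  (ord_consP E0 (fun=> Eu)).
rewrite (big_ord_cons id).
rewrite (big_ord_cons (xi^~ l)) /= !big_ord1 add0r.
by move=> /(_ erefl) h1 /(_ erefl) h2; lra.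
Qed.

(** Completing [e] to a family with sum [u] makes [xi e l] one of nonnegative terms that add up to
    1. *)
Lemma model_xi_le1 l e : E e -> xi e l <= 1.
Proof.
move=> Ee; have [[K [f [Ef fE]]]|[f [Ef [s fs sE]]]] := gpt_complement gpt Ee.
  have := ncm_xi_sum1_finite ncm l (ord_consP Ee Ef).
  rewrite (big_ord_cons id).
  rewrite (big_ord_cons (xi^~ l)) => /(_ fE) <-.
  by rewrite lerDl sumr_ge0// => i _; exact: (ncm_xi_ge0 ncm).
have := dot_has_sum_cons e fs; rewrite sE; set g := (fun k => _) => gu.
have Eg k : E (g k) by case: k.
have glim := ncm_xi_sum1_countable ncm l Eg gu.
have /nondecreasing_cvgn_le : nondecreasing_seq (series (fun k => xi (g k) l)).
  by apply: nondecreasing_series => k _ _; exact: (ncm_xi_ge0 ncm).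
(* The partial sum at index 1 consists of the term of [e] alone. *)
move=> /(_ (cvgP _ glim) 1); rewrite (cvg_lim _ glim)//.
by rewrite /series /= big_nat1.
Qed.

Lemma model_mu_dot l : exists w, forall rho, Omega rho -> mu rho l = dot w rho.
Proof.
apply: dot_extension tomo.1 _ => n c a Oa ca0.
apply: (convex_linear_relation (gpt_states_convex gpt)
  (ncm_mu_convex_linear ncm l)) => //; first exact: (gpt_states_nonempty gpt).
(* Every state pairs to 1 with [u], so pairing the relation with [u] yields the sum of its
   weights. *)
transitivity (dot (\sum_i c i *: a i) u); last by rewrite ca0 linear0l.
rewrite linear_sumlz; apply: eq_bigr => i _.
by rewrite linearZl_LR /= (gpt_dot_unit gpt)// mulr1.
Qed.

Lemma model_xi_dot l : exists w, forall e, E e -> xi e l = dot w e.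
Proof.
apply: dot_extension tomo.2 _ => n c a Ea ca0.
apply: (convex_linear_relation0 (gpt_effects_convex gpt)
  (ncm_xi_convex_linear ncm l)) => //; first exact: (gpt_effects0 gpt).
exact: model_xi0.
Qed.

Lemma model_simplex_embeddable : simplex_embeddable dot Omega E #|Lambda|.
Proof.
have [a aE] := choice model_mu_dot; have [b bE] := choice model_xi_dot.
pose iota := dot_row (a \o @enum_val Lambda predT).
pose kappa := dot_row (b \o @enum_val Lambda predT).
have sumE (F : Lambda -> R) : \sum_l F l = \sum_(i < #|Lambda|) F (enum_val i).
  exact: big_enum_val.
have rowE (v : 'rV[R]_#|Lambda|) :
    v = \sum_i v 0 i *: tnth [tuple 'e_i | i < #|Lambda|] i.
  by rewrite [LHS]row_sum_delta; apply: eq_bigr => i _; rewrite tnth_mktuple.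
(* The vertices are the standard basis, one per ontic state: [iota rho] has coordinates [mu rho],
   [kappa e] has coordinates [xi e], and [row_dot] is the sum over ontic states. *)
exists 'rV[R]_#|Lambda|, (@row_dot R #|Lambda|), [tuple 'e_i | i < #|Lambda|],
  iota, kappa; split.
- by rewrite dimvf; exact: mul1n.
- apply/freeP => k k0 i.
  have : \row_j k j = 0 :> 'rV[R]_#|Lambda|.
    rewrite [LHS]rowE -[RHS]k0; apply: eq_bigr => j _.
    by rewrite mxE -tnth_nth.
  by move=> /rowP/(_ i); rewrite !mxE.
- move=> _ [rho Orho <-]; exists (fun i => mu rho (enum_val i)); split.
  + by move=> i; exact: (ncm_mu_ge0 ncm).
  + by rewrite -sumE (ncm_mu_sum1 ncm).
  + by rewrite [LHS]rowE; apply: eq_bigr => i _; rewrite mxE -aE.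
- move=> e i Ee; rewrite tnth_mktuple.
  have kappaE : row_dot (kappa e) 'e_i = xi e (enum_val i).
    rewrite /row_dot (bigD1 i)//= big1 ?addr0 => [|j ji]; rewrite !mxE.
      by rewrite !eqxx mulr1 bE.
    by rewrite (negbTE ji) andbF mulr0.
  by rewrite /= kappaE (ncm_xi_ge0 ncm)// model_xi_le1.
- move=> rho e Orho Ee; rewrite (ncm_dot ncm)// sumE.
  by apply: eq_bigr => i _; rewrite !mxE -aE// -bE.
Qed.

End Model.

End ModelEmbedding.

Theorem proposition36 (R : realType) (V : vectType R) (dot : {dot V for idfun})
    (Omega E : set V) (u : V) (d : nat) :
  is_gpt dot Omega E u ->
  tomographically_complete Omega E ->
  simplex_embeddable dot Omega E d <-> admits_noncontextual_model dot Omega E u d.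
Proof.
move=> gpt tomo; split; first exact: simplex_embeddable_model.
by move=> [Lambda [mu [xi [<- ncm]]]]; exact: model_simplex_embeddable ncm.
Qed.
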